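(* Every $4$-regular graph of order $n$ with $n\equiv 0\pmod 4$ is balanceable.
   Context: All graphs are finite, simple and undirected. A $2$-coloring of the edges of the complete graph $K_n$ is a map $\varphi: E(K_n)\to\{R,B\}$. Such a coloring contains a balanced copy of a graph $G$ if there is a subgraph of $K_n$ isomorphic to $G$ whose edge set $E$ can be partitioned into $E_1,E_2$ with $||E_1|-|E_2||\le 1$, $\varphi(e)=R$ for all $e\in E_1$ and $\varphi(e)=B$ for all $e\in E_2$. For a graph $G$ and positive integer $n$, $\mathrm{bal}(n,G)$ is the smallest integer, if it exists, satisfying $\mathrm{bal}(n,G)<\lfloor \frac12\binom n2\rfloor$ such that every $2$-coloring $\varphi$ of $E(K_n)$ with $|\varphi^{-1}(R)|>\mathrm{bal}(n,G)$ and $|\varphi^{-1}(B)|>\mathrm{bal}(n,G)$ contains a balanced copy of $G$. A graph $G$ is balanceable if there exists an integer $n_0$ such that $\mathrm{bal}(n,G)$ exists for every integer $n\ge n_0$. *)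

(* Defs.v *)
From mathcomp Require Import all_boot.

Set Implicit Arguments.
Unset Strict Implicit.
Unset Printing Implicit Defensive.

Record sgraph := SGraph {
  vertex :> finType;
  adj : rel vertex;
  adj_sym : symmetric adj;
  adj_irr : irreflexive adj
}.

Definition edges (G : sgraph) : {set {set G}} :=
  [set [set p.1; p.2] | p : G * G & adj p.1 p.2].

Definition regular (G : sgraph) (d : nat) : Prop :=
  forall x : G, #|[set y | adj x y]| = d.

Section Complete.
Variable n : nat.

Definition complete_adj : rel 'I_n := fun x y => x != y.

Lemma complete_sym : symmetric complete_adj.
Proof. by move=> x y; rewrite /complete_adj eq_sym. Qed.

Lemma complete_irr : irreflexive complete_adj.
Proof. by move=> x; rewrite /complete_adj eqxx. Qed.

Definition complete : sgraph := SGraph complete_sym complete_irr.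

End Complete.

(* The subgraph (W, F) of H is isomorphic to G, through f. *)
Definition is_copy (G H : sgraph) (W : {set H}) (F : {set {set H}}) : Prop :=
  [/\ F \subset edges H,
      forall d, d \in F -> d \subset W
    & exists f : G -> H,
        [/\ injective f, f @: [set: G] = W
          & forall x y, adj x y = ([set f x; f y] \in F)]].

(* [true] is R and [false] is B; only the values on edges matter. *)
Definition coloring (n : nat) := {set complete n} -> bool.

Definition color_class (n : nat) (phi : coloring n) (c : bool) :
    {set {set complete n}} :=
  [set d in edges (complete n) | phi d == c].

Definition has_balanced_copy (G : sgraph) (n : nat) (phi : coloring n) : Prop :=
  exists (W : {set complete n}) (F E1 E2 : {set {set complete n}}),
    [/\ is_copy G W F,
        E1 :|: E2 = F /\ [disjoint E1 & E2],
        #|E1| <= #|E2|.+1 /\ #|E2| <= #|E1|.+1,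
        forall d, d \in E1 -> phi d = true
      & forall d, d \in E2 -> phi d = false].

Definition bal_bound (G : sgraph) (n k : nat) : Prop :=
  k < 'C(n, 2)./2 /\
  forall phi : coloring n,
    k < #|color_class phi true| -> k < #|color_class phi false| ->
    has_balanced_copy G phi.

(* bal(n, G) exists and equals k. It is taken among the nonnegative integers:
   negative thresholds all impose the same (void) condition on a coloring. *)
Definition is_bal (G : sgraph) (n k : nat) : Prop :=
  bal_bound G n k /\ forall j, bal_bound G n j -> k <= j.

Definition balanceable (G : sgraph) : Prop :=
  exists n0 : nat, forall n, n0 <= n -> exists k, is_bal G n k.

(* Main.v *)
(**
A balanced coloring of a large complete graph contains large disjoint sets [A]
and [B] on which it is homogeneous inside [A], inside [B] and between them, but
not constant: both colors are dense, so each has a large monochromatic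
biclique, whose sides contain monochromatic cliques by Ramsey's theorem; this
gives the pattern, unless there are a large red and a large blue clique, and
then pigeonhole makes the edges between them homogeneous. Mapping a vertex set
of [G] to [A] and its complement to [B], it suffices that [G], which has [4 * m]
vertices and [8 * m] edges, has a cut with [4 * m] edges and an induced subgraph
with [4 * m] edges. An independent set of size [m] gives both, so let [I] be a
maximum independent set, of size less than [m].

Cut: cuts are even, and adding to a superset of [I] one more vertex, which
already has a neighbour in it, raises the cut by at most 2; so the cuts
met on the way from [I] to a superset of [I] cutting at least half of the edges
include the value [4 * m].

Induced subgraph: the complement of [I] has maximum degree at most 3 and
[4 * m + 4 * (m - #|I|)] edges. As long as more than [4 * m] edges are left, the
average degree exceeds 2, so one can remove 3 edges at a time. The residue
modulo 3 is first adjusted by removing adjacent vertices with a single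
neighbour in [I]; there are so many of these vertices that they cannot be
independent.
*)
From Stdlib Require Import Classical.
Require Import Defs.
From mathcomp Require Import all_boot.
From mathcomp Require Import zify.

Set Implicit Arguments.
Unset Strict Implicit.
Unset Printing Implicit Defensive.

(** * Edge counts *)

Section DegreeCounts.

Variable G : sgraph.
Implicit Types (S X P Q I : {set G}) (x y v : G).

Definition deg S x := \sum_(y in S) (adj x y : nat).

(* Counts every edge inside [S] twice. *)
Definition inner S := \sum_(x in S) deg S x.

Definition cut S := \sum_(x in S) deg (~: S) x.

Definition independent S := [forall x in S, forall y in S, ~~ adj x y].

Lemma deg_set S x : deg S x = #|[set y in S | adj x y]|.
Proof.
rewrite /deg -big_mkcondr sum1_card; apply: eq_card => y.
by rewrite !inE.
Qed.

Lemma degU1 S v x : v \notin S -> deg (v |: S) x = adj x v + deg S x.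
Proof. by move=> vS; rewrite /deg big_setU1. Qed.

Lemma degD1 S v x : v \in S -> deg S x = adj x v + deg (S :\ v) x.
Proof. by move=> vS; rewrite -{1}(setD1K vS) degU1 // !inE eqxx. Qed.

Lemma degU P Q x : [disjoint P & Q] -> deg (P :|: Q) x = deg P x + deg Q x.
Proof.
move=> dPQ; rewrite /deg (eq_bigl [predU P & Q]) ?bigU //.
by move=> y; rewrite !inE.
Qed.

Lemma degC S x : deg S x + deg (~: S) x = deg setT x.
Proof. by rewrite -degU ?setUCr // -setI_eq0 setICr. Qed.

Lemma degS S X x : S \subset X -> deg S x <= deg X x.
Proof.
move=> /subsetP sSX; rewrite !deg_set subset_leq_card //; apply/subsetP => y.
by rewrite !inE => /andP[/sSX -> ->].
Qed.

Lemma deg_eq0 S x y : deg S x = 0 -> y \in S -> adj x y = false.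
Proof.
move=> d0 yS; apply/negP => xy; move: d0; rewrite (degD1 _ yS) xy.
by [].
Qed.

Lemma innerU1 S v : v \notin S -> inner (v |: S) = inner S + (deg S v).*2.
Proof.
move=> vS; rewrite /inner big_setU1 //= degU1 // adj_irr add0n -addnn.
rewrite (eq_bigr (fun x => adj x v + deg S x)); last by move=> x _; rewrite degU1.
rewrite big_split /= addnA [RHS]addnC; congr (_ + _ + _).
by apply: eq_bigr => x _; rewrite adj_sym.
Qed.

Lemma innerD1 S v : v \in S -> inner S = inner (S :\ v) + (deg S v).*2.
Proof.
move=> vS; rewrite -{1}(setD1K vS) innerU1 ?inE ?eqxx //.
by rewrite (degD1 v vS) adj_irr.
Qed.

Lemma inner0 : inner set0 = 0.
Proof. by rewrite /inner big_set0. Qed.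

(** With [inner_cut] this gives the parity of cuts: in a 4-regular graph every cut is even. *)
Lemma inner_even S : ~~ odd (inner S).
Proof.
have [n] := ubnP #|S|; elim: n S => // n IH S lt.
have [->|[v vS]] := set_0Vmem S; first by rewrite inner0.
rewrite (innerD1 vS) oddD odd_double addbF IH //.
by rewrite (cardsD1 v S) vS in lt.
Qed.

Lemma cutC S : cut (~: S) = cut S.
Proof.
rewrite /cut /deg exchange_big setCK /=.
by apply: eq_bigr => x _; apply: eq_bigr => y _; rewrite adj_sym.
Qed.

Lemma independentP S :
  reflect {in S &, forall x y, adj x y = false} (independent S).
Proof.
apply: (iffP idP) => [/'forall_in_'forall_in_negPf h x y xS yS|h]; first exact: h.
by apply/'forall_in_'forall_in_negPf => x xS y yS; apply: h.
Qed.

Lemma independent_inner S : independent S -> inner S = 0.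
Proof.
move/independentP => h; rewrite /inner big1 // => x xS.
by rewrite /deg big1 // => y yS; rewrite h.
Qed.

Lemma independent0 : independent set0.
Proof. by apply/independentP => x; rewrite inE. Qed.

Lemma independentS S X : S \subset X -> independent X -> independent S.
Proof.
move=> /subsetP sSX /independentP h; apply/independentP => x y xS yS.
by rewrite h ?sSX.
Qed.

Lemma independentU1 S v : independent S -> deg S v = 0 -> independent (v |: S).
Proof.
move=> /independentP h d0; apply/independentP => x y.
rewrite !inE => /orP[/eqP->|xS] /orP[/eqP->|yS]; rewrite ?adj_irr //.
- exact: deg_eq0 d0 yS.
- by rewrite adj_sym (deg_eq0 d0 xS).
- exact: h.
Qed.

Lemma not_independent S :
  ~~ independent S -> exists x y, [/\ x \in S, y \in S & adj x y].
Proof.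
move/forall_inPn => [x xS] /forall_inPn[y yS]; rewrite negbK => xy.
by exists x, y.
Qed.

(* Placing the vertices outside [I] one after the other on the side where they
   have fewer neighbours leaves at most half of the edges uncut. *)
Lemma greedy_bipartition I (T : {set G}) : independent I -> [disjoint I & T] ->
  exists P Q, [/\ I \subset P, [disjoint P & Q], P :|: Q = I :|: T &
    (inner P + inner Q).*2 <= inner (I :|: T)].
Proof.
move=> indI; have [n] := ubnP #|T|; elim: n T => // n IH T lt dIT.
have [->|[v vT]] := set_0Vmem T.
  exists I, set0; rewrite setU0 inner0 independent_inner //.
  by rewrite -setI_eq0 setI0 eqxx subxx.
have dIT' : [disjoint I & T :\ v].
  by rewrite disjoint_sym; apply: disjointWl (subsetDl T [set v]) _; rewrite disjoint_sym.
have [||P [Q [IP dPQ PQ le]]] := IH (T :\ v); rewrite ?(cardsD1 v T) ?vT // in lt *.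
have vI : v \notin I by apply/negP => vI; move: (disjointFr dIT vI); rewrite vT.
have vPQ : v \notin P :|: Q by rewrite PQ !inE eqxx (negPf vI).
have [vP vQ] : v \notin P /\ v \notin Q by move: vPQ; rewrite inE negb_or => /andP[].
have eqT : I :|: T = v |: (P :|: Q) by rewrite PQ setUCA setD1K.
have dv : deg (P :|: Q) v = deg P v + deg Q v by rewrite degU.
have iv : inner (I :|: T) = inner (P :|: Q) + (deg P v + deg Q v).*2.
  by rewrite eqT innerU1 // dv.
rewrite -PQ in le.
have [ledeg|ledeg] := leqP (deg P v) (deg Q v).
- exists (v |: P), Q; split.
  + exact: subset_trans IP (subsetU1 _ _).
  + by rewrite -setI_eq0 setIUl setU_eq0 !setI_eq0 disjoints1 vQ.
  + by rewrite eqT setUA.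
  + by rewrite iv innerU1 //; lia.
- exists P, (v |: Q); split => //.
  + by rewrite disjoint_sym -setI_eq0 setIUl setU_eq0 !setI_eq0 disjoints1 vP disjoint_sym.
  + by rewrite eqT setUCA.
  + by rewrite iv innerU1 //; lia.
Qed.

End DegreeCounts.

(** * Half cuts and half induced subgraphs *)

Lemma subset_card (T : finType) (S : {set T}) k :
  k <= #|S| -> exists2 X : {set T}, X \subset S & #|X| = k.
Proof.
case/card_geqP => s [uniq_s <- sS]; exists [set x in s].
  by apply/subsetP => x; rewrite inE => /sS.
by rewrite cardsE (card_uniqP uniq_s).
Qed.

Section FourRegular.

Variables (G : sgraph) (m : nat).
Hypotheses (cardG : #|G| = 4 * m) (reg : regular G 4).
Implicit Types (S X P Q I D T : {set G}) (x y v : G).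

Lemma degT x : deg setT x = 4.
Proof. by rewrite deg_set -[RHS](reg x); apply: eq_card => y; rewrite !inE. Qed.

Lemma degC4 S x : deg S x + deg (~: S) x = 4.
Proof. by rewrite degC degT. Qed.

Lemma inner_cut S : inner S + cut S = 4 * #|S|.
Proof.
rewrite /inner /cut -big_split /= (eq_bigr (fun=> 4)); last by move=> x _; rewrite degC4.
by rewrite sum_nat_const mulnC.
Qed.

Lemma innerT : inner [set: G] = 16 * m.
Proof.
rewrite /inner (eq_bigr (fun=> 4)); last by move=> x _; rewrite degT.
by rewrite sum_nat_const cardsT cardG; lia.
Qed.

Lemma cardC S : #|S| + #|~: S| = 4 * m.
Proof. by rewrite -cardG cardsC. Qed.

(** A set and its complement have the same cut, so their values of [inner] differ by four times the
    difference of their sizes. *)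
Lemma innerC S : inner (~: S) + 8 * #|S| = 16 * m + inner S.
Proof.
have := inner_cut S; have := inner_cut (~: S); have := cardC S.
by rewrite cutC; lia.
Qed.

Lemma independent_innerC I : independent I -> inner (~: I) + 8 * #|I| = 16 * m.
Proof. by move=> /independent_inner i0; rewrite innerC i0 addn0. Qed.

Lemma maximum_independent :
  exists I, independent I /\ forall X, independent X -> #|X| <= #|I|.
Proof.
have i0 := independent0 G.
case: (@arg_maxnP _ set0 (@independent G) (fun X => #|X|) i0) => I indI maxI.
by exists I.
Qed.

Lemma maximum_deg_gt0 I v : independent I ->
  (forall X, independent X -> #|X| <= #|I|) -> v \notin I -> 0 < deg I v.
Proof.
move=> indI maxI vI; rewrite lt0n; apply/eqP => d0.
by have := maxI _ (independentU1 indI d0); rewrite cardsU1 vI; lia.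
Qed.

Lemma exists_half_cut : exists X, cut X = 4 * m.
Proof.
have [I [indI maxI]] := maximum_independent.
have cutI X : independent X -> cut X = 4 * #|X|.
  by move=> /independent_inner i0; rewrite -inner_cut i0.
have [ge|lt] := leqP m #|I|.
  have [X sXI <-] := subset_card ge; exists X; apply: cutI.
  exact: independentS sXI indI.
have [Y IY cutY] : exists2 Y : {set G}, I \subset Y & 4 * m <= cut Y.
  have dI : [disjoint I & ~: I] by rewrite -setI_eq0 setICr.
  have [P [Q [IP dPQ PQ le]]] := greedy_bipartition indI dI.
  exists P => //; rewrite setUCr innerT in le PQ.
  have eQ : Q = ~: P.
    apply/setP => x; move/setP/(_ x): PQ; rewrite !inE.
    by have [/(disjointFr dPQ)->|/=] := boolP (x \in P).
  have := inner_cut P; have := innerC P; rewrite eQ in le; lia.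
(* A minimal such [Z] is strictly larger than [I], because [I] itself cuts only [4 * #|I| < 4 * m]
   edges. *)
pose good (Z : {set G}) := (I \subset Z) && (4 * m <= cut Z).
have gY : good Y by rewrite /good IY.
case: (@arg_minnP _ Y good (fun Z => #|Z|) gY) => Z /andP[IZ cutZ] minZ.
have [eZ|[v]] := set_0Vmem (Z :\: I).
  have eZI : Z = I by apply/eqP; rewrite eqEsubset IZ andbT -setD_eq0 eZ.
  by move: cutZ; rewrite eZI cutI //; lia.
rewrite inE => /andP[vI vZ]; exists Z.
have IZv : I \subset Z :\ v by rewrite subsetD1 IZ.
have small : cut (Z :\ v) < 4 * m.
  rewrite ltnNge; apply/negP => h.
  by have := minZ (Z :\ v); rewrite /good IZv h (cardsD1 v Z) vZ => /(_ isT); lia.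
have dv : 0 < deg (Z :\ v) v.
  exact: leq_trans (maximum_deg_gt0 indI maxI vI) (degS _ IZv).
(* Adding [v] to [Z :\ v] changes the cut by [4 - 2 * deg (Z :\ v) v <= 2]. The smaller cut is even
   and below [4 * m], hence at most [4 * m - 2], so [cut Z] is exactly [4 * m]. *)
have := inner_cut Z; have := inner_cut (Z :\ v).
have := innerD1 vZ; have := odd_double_half (inner Z); have := cardsD1 v Z.
move: cutZ; rewrite vZ (negPf (inner_even Z)); have := degD1 v vZ; rewrite adj_irr; lia.
Qed.

Lemma exists_deg3 D : 2 * #|D| < inner D -> exists2 v, v \in D & 2 < deg D v.
Proof.
move=> lt; apply/exists_inP; apply: contraT => /exists_inPn h.
move: lt; rewrite ltnNge mulnC -sum_nat_const.
by case/negP; apply: leq_sum => x xD; rewrite leqNgt h.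
Qed.

(** As [#|D| <= 4 * m], a value of [inner D] above [8 * m] means average degree above 2, hence a
    vertex of degree exactly 3. Deleting it lowers [inner] by 6 and keeps the degree bound. *)
Lemma remove_by_threes D q : {in D, forall v, deg D v <= 3} ->
  inner D = 8 * m + 6 * q -> exists W : {set G}, inner W = 8 * m.
Proof.
elim: q D => [|q IH] D le3 iD; first by exists D; rewrite iD muln0 addn0.
have [|v vD v3] := @exists_deg3 D.
  by have := cardC D; rewrite iD; lia.
have e3 : deg D v = 3 by apply/eqP; rewrite eqn_leq le3.
have := innerD1 vD; have := degD1 v vD; rewrite adj_irr e3 => d3 i3.
apply: (IH (D :\ v)); last by lia.
move=> x; rewrite inE => /andP[_ xD]; apply: leq_trans (le3 x xD).
by rewrite (degD1 x vD) leq_addl.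
Qed.

(** * Half induced subgraph when the independence number is below [m] *)

Section Removal.

Variable I : {set G}.
Hypotheses (indI : independent I)
           (maxI : forall X, independent X -> #|X| <= #|I|)
           (ltI : #|I| < m).

Let D0 := ~: I.
(** Deleting one vertex of [priv] from [D0] removes 3 edges; deleting two adjacent ones removes 5,
    which shifts the residue modulo 3. *)
Let priv := [set x in D0 | deg I x == 1].

Lemma deg_compl_le x : x \in D0 -> deg D0 x <= 3.
Proof.
rewrite inE => /(maximum_deg_gt0 indI maxI).
by have := degC4 I x; rewrite -/D0; lia.
Qed.

Lemma deg_compl_in x : x \in I -> deg D0 x = 4.
Proof.
move=> xI; have := degC4 I x; rewrite -/D0 /deg big1 // => y yI.
by move/independentP: indI => ->.
Qed.

Lemma deg_priv x : x \in priv -> deg D0 x = 3.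
Proof.
by rewrite inE => /andP[_ /eqP d1]; have := degC4 I x; rewrite -/D0 d1; lia.
Qed.

Lemma priv_in x : x \in priv -> x \in D0.
Proof. by rewrite inE => /andP[]. Qed.

(** Count the [4 * #|I|] edges leaving [I]: by maximality each of the [4 * m - #|I|] outer vertices
    receives at least one, and at least two unless it lies in [priv]. *)
Lemma card_priv : 8 * m <= #|priv| + 6 * #|I|.
Proof.
have e : \sum_(x in D0) deg I x = 4 * #|I|.
  have := inner_cut D0; rewrite /cut /D0 setCK => E1.
  have := independent_innerC indI; have := cardC I; rewrite -/D0 in E1 *; lia.
have : \sum_(x in D0) 2 <= \sum_(x in D0) (deg I x + (x \in priv)).
  apply: leq_sum => x xD; rewrite !inE in xD *; rewrite xD /=.
  by have := maximum_deg_gt0 indI maxI xD; case: eqP; lia.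
rewrite sum_nat_const big_split /= e.
have -> : \sum_(x in D0) (x \in priv : nat) = #|priv|.
  rewrite -big_mkcondr sum1_card; apply: eq_card => x.
  by rewrite [in LHS]unfold_in !inE; case: (x \in I).
by have := cardC I; rewrite -/D0; lia.
Qed.

Lemma adjacent_pair T : #|I| < #|T| ->
  exists x y, [/\ x \in T, y \in T & adj x y].
Proof.
move=> lt; apply: not_independent; apply/negP => /maxI.
by rewrite leqNgt lt.
Qed.

(** This is the closed neighbourhood of the pair, that is, the vertices to stay away from: deleting
    [x] and [y] does not change the degree of a vertex outside it. *)
Definition far x y := [set z | [|| z == x, z == y, adj x z | adj y z]].

Lemma card_far x y : adj x y -> #|far x y| <= 8.
Proof.
move=> xy.
have -> : far x y = [set z | adj x z] :|: [set z | adj y z].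
  apply/setP => z; rewrite !inE; case: eqP => [->|_]; first by rewrite (adj_sym y x) xy orbT.
  by case: eqP => [->|_] //; rewrite xy.
by apply: leq_trans (leq_card_setU _ _) _; rewrite !reg.
Qed.

Lemma innerD1_deg D v d : v \in D -> deg D v = d -> inner D = inner (D :\ v) + d.*2.
Proof. by move=> vD <-; apply: innerD1. Qed.

Lemma degD1_sub D v x : v \in D -> deg (D :\ v) x = deg D x - adj x v.
Proof. by move=> vD; rewrite (degD1 x vD) addKn. Qed.

Lemma exists_half_inner_lt : exists W : {set G}, inner W = 8 * m.
Proof.
have cP := card_priv; have iD := independent_innerC indI; rewrite -/D0 in iD.
have cD : #|priv| <= #|D0| by apply/subset_leq_card/subsetP/priv_in.
have cI := cardC I; rewrite -/D0 in cI.
have sub3 D : D \subset D0 -> {in D, forall v, deg D v <= 3}.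
  move=> sD x xD; apply: leq_trans (degS x sD) (deg_compl_le _).
  exact: subsetP sD x xD.
have [b [b' [bP b'P bb']]] : exists x y, [/\ x \in priv, y \in priv & adj x y].
  by apply: adjacent_pair; move: cP ltI; clear; lia.
have neb : b' != b by apply: contraTneq bb' => ->; rewrite adj_irr.
have bD := priv_in bP; have b'D : b' \in D0 :\ b by rewrite !inE neb -in_setC priv_in.
have iD1 : inner D0 = inner (D0 :\ b) + 6 by apply: (@innerD1_deg _ _ 3) => //; apply: deg_priv.
set D2 := D0 :\ b :\ b'.
have iD2 : inner (D0 :\ b) = inner D2 + 4.
  by apply: (@innerD1_deg _ _ 2) => //; rewrite degD1_sub // deg_priv // adj_sym bb'.
have sD2 : D2 \subset D0 by apply: subset_trans (subD1set _ _) (subD1set _ _).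
have degD2 x : deg D2 x = deg D0 x - adj b x - adj b' x.
  by rewrite !degD1_sub // (adj_sym b) (adj_sym b').
have inD2 x : (x \in D2) = [&& x != b', x != b & x \in D0] by rewrite !in_setD1.
have : #|I| + (m - #|I|) = m by rewrite subnKC // ltnW.
move: (m - #|I|) => k ek.
(* There are [4 * k] edges too many in [D0], which is [k] modulo 3. Residue 2 is fixed by deleting
   one adjacent pair of [priv] (5 edges), residue 1 by deleting two pairs (10 edges); for [k = 1]
   the excess of 4 edges is too small for that. *)
have : [\/ k = 3 * (k %/ 3), k = 3 * (k %/ 3) + 2, k = 1 |
           exists q, k = 3 * q.+1 + 1].
  have := ltI; have := divn_eq k 3; have := ltn_pmod k (isT : 0 < 3).
  case: (k %% 3) => [|[|[|//]]] _ eq ltIm.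
  - by constructor 1; lia.
  - case eq' : (k %/ 3) => [|q]; first by constructor 3; lia.
    by constructor 4; exists q; lia.
  - by constructor 2; lia.
move: (k %/ 3) => q.
case=> [k0|k2|k1|[{}q k4]].
- apply: (@remove_by_threes D0 (4 * q)); first exact: sub3.
  by move: iD ek k0; clear; lia.
- apply: (@remove_by_threes D2 (4 * q + 1)); first exact: sub3.
  by move: iD iD1 iD2 ek k2; clear; lia.
(* Here [2 * #|I| + 8 <= #|priv| <= #|D0| = 3 * #|I| + 4], so [#|I| >= 4] and [#|priv| >= 16], more
   than the 8 vertices of [far b b']. *)
- have [a aP aF] : exists2 a, a \in priv & a \notin far b b'.
    apply/subsetPn; apply/negP => /subset_leq_card.
    by have := card_far bb'; move: cP cD cI ek k1; clear; lia.
  move: (aF); rewrite inE !negb_or => /and4P[nab nab' /negPf ba /negPf b'a].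
  have aD : a \in D2 by rewrite inD2 nab nab' priv_in.
  have iD3 : inner D2 = inner (D2 :\ a) + 6.
    by apply: (@innerD1_deg _ _ 3) => //; rewrite degD2 ba b'a deg_priv.
  (* The vertices [a], [b], [b'] have one neighbour each in [I], which has at least 4 elements. *)
  have [c cI' /and3P[/negPf ac /negPf bc /negPf b'c]] :
      exists2 c, c \in I & [&& ~~ adj a c, ~~ adj b c & ~~ adj b' c].
    apply/exists_inP; apply: contraT => /exists_inPn h.
    have p1 x : x \in priv -> \sum_(c in I) adj x c = 1.
      by rewrite inE => /andP[_ /eqP].
    have : \sum_(c in I) 1 <= \sum_(c in I) (adj a c + adj b c + adj b' c).
      apply: leq_sum => c /h.
      by case: (adj a c); case: (adj b c); case: (adj b' c).
    rewrite sum1_card !big_split /= !p1 //.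
    by move: cP cD cI ek k1; clear; lia.
  have cD2 : c \notin D2 :\ a by rewrite in_setD1 inD2 !inE cI' !andbF.
  (* Here 4 edges must go: [c] brings back 4, while [b], [b'] and [a] take 8. *)
  exists (c |: (D2 :\ a)); rewrite innerU1 //.
  rewrite degD1_sub // degD2 bc b'c (adj_sym c) ac deg_compl_in //.
  by move: iD iD1 iD2 iD3 ek k1; clear; rewrite -!addnn /=; lia.
(* A second pair, not touching the first one, removes 5 more edges. At least [2 * #|I| + 8 * k - 8]
   vertices of [priv] remain outside [far b b'], too many to be independent. *)
- have [a [a' [aP a'P aa']]] : exists x y,
      [/\ x \in priv :\: far b b', y \in priv :\: far b b' & adj x y].
    apply: adjacent_pair; have := cardsID (far b b') priv.
    have : #|priv :&: far b b'| <= 8.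
      by apply: leq_trans (card_far bb'); rewrite subset_leq_card // subsetIr.
    have : 0 < #|I|.
      rewrite lt0n; apply/eqP => I0.
      have /maxI : independent [set b].
        by apply/independentP => x y /set1P-> /set1P->; rewrite adj_irr.
      by rewrite cards1 I0.
    by move: cP ek k4; clear; lia.
  move: aP a'P; rewrite !in_setD [a \in far _ _]inE [a' \in far _ _]inE !negb_or.
  case/andP => /and4P[nab nab' /negPf ba /negPf b'a] aP.
  case/andP => /and4P[na'b na'b' /negPf ba' /negPf b'a'] a'P.
  have nea : a' != a by apply: contraTneq aa' => ->; rewrite adj_irr.
  have aD : a \in D2 by rewrite inD2 nab nab' priv_in.
  have a'D : a' \in D2 :\ a by rewrite in_setD1 nea inD2 na'b na'b' priv_in.
  have iD3 : inner D2 = inner (D2 :\ a) + 6.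
    by apply: (@innerD1_deg _ _ 3) => //; rewrite degD2 ba b'a deg_priv.
  have iD4 : inner (D2 :\ a) = inner (D2 :\ a :\ a') + 4.
    apply: (@innerD1_deg _ _ 2) => //.
    by rewrite degD1_sub // degD2 ba' b'a' (adj_sym a') aa' deg_priv.
  apply: (@remove_by_threes (D2 :\ a :\ a') (4 * q + 2)).
    apply: sub3; apply: subset_trans sD2.
    by apply: subset_trans (subD1set _ _) (subD1set _ _).
  by move: iD iD1 iD2 iD3 iD4 ek k4; clear; lia.
Qed.

End Removal.

Lemma exists_half_inner : exists W : {set G}, inner W = 8 * m.
Proof.
have [I [indI maxI]] := maximum_independent.
have [ge|] := leqP m #|I|; last exact: exists_half_inner_lt.
have [C sCI cC] := subset_card ge; exists (~: C).
by have := independent_innerC (independentS sCI indI); lia.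
Qed.

End FourRegular.

(** * Unavoidable patterns *)

Section Ramsey.

Variable T : finType.
Implicit Types (A B K L Q Z : {set T}) (e : rel T).

Lemma ramsey e s t A : symmetric e -> 2 ^ (s + t) <= #|A| ->
  (exists K, [/\ K \subset A, #|K| = s & {in K &, forall x y, x != y -> e x y}]) \/
  (exists K, [/\ K \subset A, #|K| = t & {in K &, forall x y, x != y -> ~~ e x y}]).
Proof.
move=> sym_e; have [n] := ubnP (s + t); elim: n s t A => // n IH s t A lt le.
case: s => [|s] in lt le *.
  by left; exists set0; rewrite sub0set cards0; split=> // x y; rewrite inE.
case: t => [|t] in lt le *.
  by right; exists set0; rewrite sub0set cards0; split=> // x y; rewrite inE.
have [x xA] : exists x, x \in A.
  by apply/card_gt0P; apply: leq_trans le; rewrite expn_gt0.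
pose N := [set y in A :\ x | e x y]; pose M := [set y in A :\ x | ~~ e x y].
have NA : N \subset A by apply/subsetP => y; rewrite !inE => /andP[/andP[]].
have MA : M \subset A by apply/subsetP => y; rewrite !inE => /andP[/andP[]].
have cNM : #|A| = (#|N| + #|M|).+1.
  rewrite (cardsD1 x A) xA -(cardsID [set y | e x y] (A :\ x)) add1n.
  by congr (_ + _).+1; apply: eq_card => y; rewrite !inE // andbC.
(* Both powers are half of the assumed bound on [#|A|], so losing [x] still leaves one side large
   enough. *)
have : 2 ^ (s + t.+1) <= #|N| \/ 2 ^ (s.+1 + t) <= #|M|.
  by move: le; rewrite cNM addSn addnS addSn !expnS; lia.
have ext K (W : {set T}) (c : bool) : K \subset W -> W = [set y in A :\ x | e x y == c] ->
    {in K &, forall y z, y != z -> e y z == c} ->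
    #|x |: K| = #|K|.+1 /\ {in x |: K &, forall y z, y != z -> e y z == c}.
  move=> /subsetP KW eW h.
  have KP y : y \in K -> y != x /\ e x y == c.
    by move/KW; rewrite eW !inE => /andP[/andP[]].
  split; first by rewrite cardsU1; case: (boolP (x \in K)) => // /KP[]; rewrite eqxx.
  move=> y z; rewrite !inE => /orP[/eqP->|yK] /orP[/eqP->|zK]; rewrite ?eqxx //.
  - by case: (KP z zK).
  - by rewrite sym_e; case: (KP y yK).
  - exact: h.
have eN : N = [set y in A :\ x | e x y == true].
  by apply/setP => y; rewrite !inE eqb_id.
have eM : M = [set y in A :\ x | e x y == false].
  by apply/setP => y; rewrite !inE eqbF_neg.
case=> h.
- have ltn : s + t.+1 < n by lia.
  have [[K [KN cK hK]]|[K [KN cK hK]]] := IH s t.+1 N ltn h.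
  + left; exists (x |: K).
    have [|cxK hxK] := ext K N true KN eN; first by move=> y z yK zK /(hK y z yK zK) ->.
    rewrite cxK cK; split=> // [|y z yK zK yz]; last by rewrite -[e y z]eqb_id hxK.
    by rewrite subUset sub1set xA (subset_trans KN).
  + by right; exists K; split=> //; apply: subset_trans KN NA.
- have ltn : s.+1 + t < n by lia.
  have [[K [KN cK hK]]|[K [KN cK hK]]] := IH s.+1 t M ltn h.
  + by left; exists K; split=> //; apply: subset_trans KN MA.
  + right; exists (x |: K).
    have [|cxK hxK] := ext K M false KN eM.
      by move=> y z yK zK /(hK y z yK zK); rewrite eqbF_neg.
    rewrite cxK cK; split=> // [|y z yK zK yz]; last by rewrite -eqbF_neg hxK.
    by rewrite subUset sub1set xA (subset_trans KN).
Qed.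

(** Pigeonhole over the [2 ^ #|Q|] subsets of [Q]. It is applied to the neighbourhoods in [Q] of the
    vertices of [Z]. *)
Lemma common_trace (f : T -> {set T}) Z Q s :
    {in Z, forall x, f x \subset Q} -> s * 2 ^ #|Q| < #|Z| ->
  exists2 B : {set T}, B \subset Q & s < #|[set x in Z | f x == B]|.
Proof.
move=> fQ lt.
suff: exists2 B, B \in powerset Q & s < #|[set x in Z | f x == B]|.
  by case=> B; rewrite inE; exists B.
apply/exists_inP; apply: contraT => /exists_inPn h.
move: lt; rewrite ltnNge -card_powerset mulnC -sum_nat_const.
rewrite -sum1_card (partition_big f (mem (powerset Q))) /=; last first.
  by move=> x /fQ; rewrite inE.
case/negP; apply: leq_sum => B /h; rewrite -leqNgt.
by apply: leq_trans; rewrite sum1_card subset_leq_card //; apply/subsetP => x; rewrite !inE.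
Qed.

(* Double counting between the whole type and a bounded set [Q] of vertices of
   large degree, followed by the pigeonhole principle on the traces on [Q]. *)
Lemma dense_biclique e s (N := #|T|) :
    N * N <= 8 * \sum_x #|[set y | e x y]| ->
    2048 * s.+1 * 2 ^ (64 * s.+1) < N ->
  exists K L : {set T}, [/\ [disjoint K & L], s < #|K|, s < #|L| &
    {in K & L, forall x y, e x y}].
Proof.
move=> dense large; pose d x := #|[set y | e x y]|.
(* The size of [Q]. The factor 64 ensures that vertices with at most [s] neighbours in [Q] supply at
   most half of the [M * N / 32] pairs found in [sum_tr]. *)
set M := 64 * s.+1 in large.
have largeM : 32 * M < N.
  apply: leq_ltn_trans large; rewrite (_ : 32 * M = 2048 * s.+1); last by rewrite /M; lia.
  by rewrite leq_pmulr // expn_gt0.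
pose H := [set x | N <= 16 * d x].
have cH : M <= #|H|.
  have : \sum_x 16 * d x <= \sum_x (16 * N * (x \in H) + N).
    apply: leq_sum => x _; rewrite inE; have [_|lt] := leqP N (16 * d x).
      2: exact: leq_trans (ltnW lt) (leq_addl _ _).
    by rewrite /= muln1 (leq_trans _ (leq_addr _ _)) // leq_mul2l /= max_card.
  rewrite -big_distrr big_split /= -big_distrr /= sum_nat_const -/N.
  rewrite (_ : \sum_x (x \in H : nat) = #|H|); last by rewrite -big_mkcond sum1_card.
  rewrite -/(\sum_x d x) in dense *; set P := \sum_x d x in dense * => le.
  have : N * N <= N * (16 * #|H|) by move: le; rewrite -/N; lia.
  by rewrite leq_pmul2l; lia.
have [Q QH cQ] := subset_card cH.
pose tr v := [set q in Q | e q v].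
(* The vertices of [Q] have total degree at least [M * N / 16], and at most [M * M <= M * N / 32] of
   it stays inside [Q]. *)
have sum_tr : M * N <= 32 * \sum_(v in ~: Q) #|tr v|.
  have : \sum_(q in Q) N <= \sum_(q in Q) 16 * d q.
    by apply: leq_sum => q /(subsetP QH); rewrite inE.
  rewrite sum_nat_const cQ -big_distrr /=.
  have -> : \sum_(q in Q) d q = \sum_v #|tr v|.
    rewrite /d; transitivity (\sum_(q in Q) \sum_v (e q v : nat)).
      apply: eq_bigr => q _; rewrite -sum1_card big_mkcond.
      by apply: eq_bigr => v _; rewrite inE; case: (e q v).
    rewrite exchange_big; apply: eq_bigr => v _; rewrite -sum1_card -big_mkcondr /=.
    by apply: eq_bigl => q; rewrite inE.
  rewrite (bigID (mem Q)) /=.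
  have : \sum_(v in Q) #|tr v| <= \sum_(v in Q) M.
    apply: leq_sum => v _; rewrite -cQ subset_leq_card //.
    by apply/subsetP => q; rewrite inE => /andP[].
  rewrite sum_nat_const cQ => inQ.
  rewrite (_ : \sum_(v | v \notin Q) #|tr v| = \sum_(v in ~: Q) #|tr v|); last first.
    by apply: eq_bigl => v; rewrite inE.
  have : M * (32 * M) <= M * N by rewrite leq_mul2l (ltnW largeM) orbT.
  by clear -inQ; lia.
pose Z := [set v in ~: Q | s < #|tr v|].
have cZ : N <= 64 * #|Z|.
  have : \sum_(v in ~: Q) #|tr v| <= \sum_(v in ~: Q) (M * (v \in Z) + s.+1).
    apply: leq_sum => v vQ; rewrite [v \in Z]inE vQ /=.
    have [_|le] := ltnP s #|tr v|; last by rewrite /= muln0; apply: ltnW.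
    rewrite /= muln1 (leq_trans _ (leq_addr _ _)) // -cQ subset_leq_card //.
    by apply/subsetP => q; rewrite inE => /andP[].
  rewrite big_split /= -big_distrr /= sum_nat_const.
  have -> : \sum_(v in ~: Q) (v \in Z : nat) = #|Z|.
    rewrite -big_mkcondr sum1_card; apply: eq_card => v.
    by rewrite [in LHS]unfold_in !inE; case: (v \in Q).
  have : #|~: Q| <= N by apply: max_card.
  move: sum_tr; rewrite /M; set S := \sum_(_ in _) _; nia.
have trQ : {in Z, forall v, tr v \subset Q}.
  by move=> v _; apply/subsetP => q; rewrite inE => /andP[].
have largeZ : s * 2 ^ #|Q| < #|Z|.
  by rewrite cQ; move: large cZ; clear; set E := 2 ^ M; nia.
have [B BQ cB] := common_trace trQ largeZ.
set L := [set _ in Z | _] in cB; exists B, L; split=> //.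
- apply/pred0P => x /=; apply/negP => /andP[/(subsetP BQ) xQ].
  by rewrite !inE xQ.
- have /card_gt0P[v] : 0 < #|L| by apply: leq_trans cB.
  by rewrite !inE => /andP[/andP[_ lt] /eqP <-].
- move=> x y xB; rewrite !inE => /andP[_ /eqP eB].
  by move: xB; rewrite -eB inE => /andP[].
Qed.

(** * Homogeneous pairs of sets that are not constant *)

Definition mono e K c := {in K &, forall x y, x != y -> e x y = c}.

Definition crossing e K L c := {in K & L, forall x y, e x y = c}.

Definition unavoidable_pattern e t := exists (A B : {set T}) a b c,
  [/\ [disjoint A & B] /\ ~~ [&& a == c & b == c], t <= #|A| /\ t <= #|B|,
      mono e A a, mono e B b & crossing e A B c].

Lemma ramsey_mono e s A : symmetric e -> 2 ^ (s + s) <= #|A| ->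
  exists (K : {set T}) c, [/\ K \subset A, #|K| = s & mono e K c].
Proof.
move=> sym_e /(ramsey sym_e)[] [K [KA cK hK]]; exists K.
  by exists true; split=> // x y xK yK /(hK x y xK yK).
by exists false; split=> // x y xK yK /(hK x y xK yK)/negPf.
Qed.

Lemma monoS e K L c : K \subset L -> mono e L c -> mono e K c.
Proof. by move=> /subsetP sKL h x y xK yK; apply: h; apply: sKL. Qed.

(** The threshold of [dense_biclique] for sides of more than [2 ^ (s + s)] vertices, on which
    [ramsey_mono] yields homogeneous sets of size [s]. *)
Definition clique_bound s := 2048 * (2 ^ (s + s)).+1 * 2 ^ (64 * (2 ^ (s + s)).+1).

(** Take homogeneous sets in the two sides of a biclique of color [c]. If the first has color [c] it
    is the clique sought; otherwise the two sets form a pattern. *)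
Lemma dense_clique e s t c : symmetric e -> t <= s ->
    #|T| * #|T| <= 8 * \sum_x #|[set y | e x y == c]| -> clique_bound s < #|T| ->
  unavoidable_pattern e t \/ exists2 K : {set T}, #|K| = s & mono e K c.
Proof.
move=> sym_e ts dense large.
have [K [L [dKL cK cL hKL]]] := dense_biclique dense large.
have [A [a [AK cA hA]]] := ramsey_mono sym_e (ltnW cK).
have [B [b [BL cB hB]]] := ramsey_mono sym_e (ltnW cL).
have [/eqP ac|ac] := boolP (a == c); first by right; exists A; rewrite -?ac.
left; exists A, B, a, b, c; rewrite (negPf ac) cA cB; split=> //.
  by split=> //; apply: disjointWl AK _; apply: disjointWr BL _.
by move=> x y /(subsetP AK) xK /(subsetP BL) yL; apply/eqP/hKL.
Qed.

(** Many vertices of [L] have the same trace on [2 * t] vertices of [K]; either the trace or its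
    complement has [t] elements and is joined homogeneously to them. The cliques have different
    colors, so any crossing color gives a pattern. *)
Lemma cliques_pattern e t K L c : symmetric e ->
  2 * t < #|K| -> t * 2 ^ (2 * t) + 1 < #|L| -> mono e K c -> mono e L (~~ c) ->
  unavoidable_pattern e t.
Proof.
move=> sym_e cK cL hK hL.
(* An edge inside the intersection would have both colors. This one possible common vertex accounts
   for the slack in both size hypotheses. *)
have cKL : #|K :&: L| <= 1.
  rewrite leqNgt; apply/negP => /card_gt1P[x [y [xKL yKL nxy]]].
  move: xKL yKL; rewrite !inE => /andP[xK xL] /andP[yK yL].
  by have := hK x y xK yK nxy; rewrite (hL x y xL yL nxy); case: (c).
have [|Q QK cQ] := @subset_card _ (K :\: L) (2 * t).
  by have := cardsID L K; lia.
have QK' : Q \subset K by apply: subset_trans QK (subsetDl _ _).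
pose tr v := [set q in Q | e q v].
have trQ : {in L :\: K, forall v, tr v \subset Q}.
  by move=> v _; apply/subsetP => q; rewrite inE => /andP[].
have largeL : t * 2 ^ #|Q| < #|L :\: K|.
  by rewrite cQ; have := cardsID K L; rewrite setIC; lia.
have [B BQ cB] := common_trace trQ largeL.
set L' := [set _ in _ | _] in cB.
have L'L : L' \subset L by apply/subsetP => v; rewrite !inE => /andP[/andP[]].
have dQL A : A \subset Q -> [disjoint A & L'].
  move=> AQ; apply/pred0P => x /=; apply/negP => /andP[/(subsetP AQ) /(subsetP QK)].
  by rewrite !inE => /andP[/negPf-> _]; rewrite andbF.
have pattern A d : A \subset Q -> t <= #|A| -> crossing e A L' d -> unavoidable_pattern e t.
  move=> AQ cA hA; exists A, L', c, (~~ c), d; split.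
  - by split; [exact: dQL | case: (c); case: (d)].
  - by split=> //; apply: ltnW.
  - exact: monoS (subset_trans AQ QK') hK.
  - exact: monoS L'L hL.
  - exact: hA.
have cBQ : #|B| + #|Q :\: B| = 2 * t by rewrite -cQ -(cardsID B Q) (setIidPr BQ).
have [le|lt] := leqP t #|B|.
  apply: (pattern B true) => // x y xB; rewrite !inE => /andP[_ /eqP eB].
  by move: xB; rewrite -eB inE => /andP[].
apply: (pattern (Q :\: B) false); rewrite ?subsetDl //; first by lia.
move=> x y; rewrite !inE => /andP[xB xQ] /andP[_ /eqP eB].
by move: xB; rewrite -eB inE xQ => /negPf.
Qed.

Lemma balanced_pattern e t (s := t * 2 ^ (2 * t) + 2 * t + 2) : symmetric e ->
    (forall c, #|T| * #|T| <= 8 * \sum_x #|[set y | e x y == c]|) ->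
    clique_bound s < #|T| ->
  unavoidable_pattern e t.
Proof.
move=> sym_e dense large; have ts : t <= s by rewrite /s; lia.
have [//|[K cK hK]] := dense_clique sym_e ts (dense true) large.
have [//|[L cL hL]] := dense_clique sym_e ts (dense false) large.
by apply: (@cliques_pattern e t K L true); rewrite ?cK ?cL // /s; lia.
Qed.

End Ramsey.

(** * Balanced copies *)

(** Serves to pass from ordered adjacent pairs to edges, each edge coming from its two
    orientations. *)
Lemma card_double_fiber (aT rT : finType) (h : aT -> rT) (P : {set aT}) :
    {in P, forall p, #|[set q in P | h q == h p]| = 2} ->
  #|P| = 2 * #|h @: P|.
Proof.
move=> h2; rewrite -sum1_card (partition_big_imset h) /= mulnC -sum_nat_const.
apply: eq_bigr => _ /imsetP[p pP ->]; rewrite sum1_card -(h2 p pP).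
by apply: eq_card => q; rewrite [in LHS]unfold_in !inE.
Qed.

Lemma pair_set_eq (T : finType) (a b x y : T) :
  ([set a; b] == [set x; y]) = ((a, b) == (x, y)) || ((a, b) == (y, x)).
Proof.
apply/eqP/idP => [/setP E|/orP[]/eqP[-> ->] //]; last by rewrite setUC.
have := E a; have := E b; have := E x; have := E y.
rewrite !inE !eqxx ?orbT !xpair_eqE /=.
rewrite (eq_sym x a) (eq_sym x b) (eq_sym y a) (eq_sym y b).
by case: (a == x); case: (b == y); case: (a == y); case: (b == x).
Qed.

Section Copies.

Variables (G : sgraph) (n : nat) (phi : coloring n) (f : G -> complete n).
Hypothesis inj_f : injective f.

Let img (p : G * G) := [set f p.1; f p.2].

Let arcs := [set p : G * G | adj p.1 p.2].

(* Counts every edge of color [c] in the copy of [G] twice. *)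
Definition color_count c :=
  \sum_x \sum_(y : G) ((adj x y && (phi [set f x; f y] == c)) : nat).

Lemma img_eq (x y : G) q : (img q == img (x, y)) = (q == (x, y)) || (q == (y, x)).
Proof.
by case: q => u v; rewrite /img pair_set_eq !xpair_eqE !(inj_eq inj_f).
Qed.

Lemma copy_of_injection : is_copy G (f @: [set: G]) (img @: arcs).
Proof.
split.
- apply/subsetP => _ /imsetP[[x y] + ->]; rewrite inE /= => xy.
  apply/imsetP; exists (f x, f y) => //.
  rewrite inE /= /complete_adj (inj_eq inj_f).
  by apply: contraTneq xy => ->; rewrite adj_irr.
- by move=> _ /imsetP[[x y] _ ->]; apply/subsetP => z /set2P[]->; apply: imset_f.
- exists f; split=> // x y; apply/idP/imsetP => [xy|[q qA /eqP]].
    by exists (x, y); rewrite ?inE.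
  rewrite eq_sym [_ == _]img_eq; rewrite inE in qA.
  by case/orP => /eqP eq; rewrite eq /= in qA; rewrite // adj_sym.
Qed.

Lemma card_color c :
  color_count c = 2 * #|[set d in img @: arcs | phi d == c]|.
Proof.
pose P := [set p in arcs | phi (img p) == c].
have -> : [set d in img @: arcs | phi d == c] = img @: P.
  apply/setP => d; rewrite inE; apply/andP/imsetP => [[/imsetP[p pA ->] dc]|[p]].
    by exists p; rewrite // inE pA.
  by rewrite inE => /andP[pA pc] ->; rewrite imset_f.
rewrite -card_double_fiber => [|[x y]].
  rewrite /color_count pair_bigA /= -big_mkcond sum1_card; apply: eq_card => p.
  by rewrite [in LHS]unfold_in !inE.
rewrite !inE => /andP[/= xy xyc].
have nxy : (x, y) != (y, x).
  by apply: contraTneq xy => -[->]; rewrite adj_irr.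
have <- : #|[set (x, y); (y, x)]| = 2 by rewrite cards2 nxy.
apply: eq_card => q; rewrite !inE img_eq.
have [->|_] := eqVneq q (x, y); first by rewrite xy xyc.
have [->|_] := eqVneq q (y, x); last by rewrite andbF.
by rewrite /= adj_sym xy /img setUC xyc.
Qed.

Lemma has_balanced_copy_of_count :
  color_count true = color_count false -> has_balanced_copy G phi.
Proof.
rewrite !card_color => /eqP; rewrite eqn_pmul2l // => /eqP eqc.
exists (f @: [set: G]), (img @: arcs).
exists [set d in img @: arcs | phi d == true], [set d in img @: arcs | phi d == false].
split.
- exact: copy_of_injection.
- split.
    by apply/setP => d; rewrite !inE; case: (phi d); rewrite /= ?andbT ?andbF ?orbF.
  by apply/pred0P => d; rewrite /= !inE; case: (phi d); rewrite ?andbF.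
- by rewrite eqc leqnSn.
- by move=> d; rewrite inE => /andP[_ /eqP].
- by move=> d; rewrite inE => /andP[_ /eqP].
Qed.

Lemma color_count_total : color_count true + color_count false = inner [set: G].
Proof.
rewrite /color_count /inner /deg -big_split /=; apply: eq_big => [x|x _]; first by rewrite inE.
rewrite -big_split /=; apply: eq_big => [y|y _]; first by rewrite inE.
by case: (adj x y); case: (phi _).
Qed.

Lemma color_count_pattern (X : {set G}) (A B : {set complete n}) a b c d :
    {in X, forall x, f x \in A} -> {in ~: X, forall x, f x \in B} ->
    mono (fun x y => phi [set x; y]) A a ->
    mono (fun x y => phi [set x; y]) B b ->
    crossing (fun x y => phi [set x; y]) A B c ->
  color_count d =
    (a == d) * inner X + (b == d) * inner (~: X) + (c == d) * (2 * cut X).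
Proof.
move=> fA fB hA hB hAB.
have split_X (F : G -> nat) :
    \sum_x F x = \sum_(x in X) F x + \sum_(x in ~: X) F x.
  by rewrite (bigID (mem X)) /=; congr (_ + _); apply: eq_bigl => x; rewrite inE.
have block (U V : {set G}) (u : bool) :
    {in U & V, forall x y, adj x y -> phi [set f x; f y] = u} ->
    \sum_(x in U) \sum_(y in V) ((adj x y && (phi [set f x; f y] == d)) : nat) =
    (u == d) * \sum_(x in U) deg V x.
  move=> h; rewrite big_distrr /=; apply: eq_bigr => x xU.
  rewrite big_distrr /=; apply: eq_bigr => y yV.
  by case: (boolP (adj x y)) => [xy|_] /=; rewrite ?(h x y) ?muln1 ?muln0.
have neq_f x y : adj x y -> f x != f y.
  by rewrite (inj_eq inj_f); apply: contraTneq => ->; rewrite adj_irr.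
rewrite /color_count split_X.
rewrite (eq_bigr _ (fun x _ => split_X _)) [X in _ + X = _](eq_bigr _ (fun x _ => split_X _)).
rewrite !big_split /= (block X X a) ?(block X (~: X) c) ?(block (~: X) X c)
  ?(block (~: X) (~: X) b).
- have -> : \sum_(x in ~: X) deg X x = cut X by rewrite -cutC /cut setCK.
  rewrite -!/(inner _) -/(cut X).
  by case: (a == d); case: (b == d); case: (c == d); lia.
- by move=> x y xX yX /neq_f; apply: hB; apply: fB.
- by move=> x y xX yX _; rewrite setUC; apply: hAB; [apply: fA | apply: fB].
- by move=> x y xX yX _; apply: hAB; [apply: fA | apply: fB].
- by move=> x y xX yX /neq_f; apply: hA; apply: fA.
Qed.

End Copies.

(** * From patterns to balanced copies and the balance number *)

Lemma embed_split (G T : finType) (X : {set G}) (A B : {set T}) :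
    [disjoint A & B] -> #|G| < #|A| -> #|G| < #|B| ->
  exists f : G -> T,
    [/\ injective f, {in X, forall x, f x \in A} & {in ~: X, forall x, f x \in B}].
Proof.
move=> dAB cA cB.
have [x0 _] : exists x, x \in A by apply/card_gt0P; apply: leq_trans cA.
pose g (S : {set T}) (x : G) := nth x0 (enum S) (enum_rank x).
have lt (S : {set T}) (x : G) : #|G| < #|S| -> enum_rank x < size (enum S).
  by move=> cS; rewrite -cardE; apply: leq_trans (ltnW cS); rewrite -[#|G|]/(#|_|) ltn_ord.
have gS (S : {set T}) (x : G) : #|G| < #|S| -> g S x \in S.
  by move=> cS; rewrite -mem_enum mem_nth // lt.
have gI (S : {set T}) : #|G| < #|S| -> injective (g S).
  move=> cS x y /eqP; rewrite nth_uniq ?lt ?enum_uniq // => /eqP/val_inj.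
  exact: enum_rank_inj.
have neq x y : g A x = g B y -> False.
  by move=> E; have := disjointFr dAB (gS A x cA); rewrite E gS.
exists (fun x => if x \in X then g A x else g B x); split.
- move=> x y; case: ifP => _; case: ifP => _.
  + exact: gI.
  + by move/neq.
  + by move/esym/neq.
  + exact: gI.
- by move=> x ->; apply: gS.
- by move=> x; rewrite inE => /negPf->; apply: gS.
Qed.

(** Each edge comes from an ordered pair, so the sum, diagonal pairs included, is at least the size
    of the class. The rest is the inequality between [n * n] and [8 * ('C(n, 2)./2)], valid from
    [n = 4] on. *)
Lemma color_class_dense n (phi : coloring n) c : 4 <= n ->
    ('C(n, 2)./2).-1 < #|color_class phi c| ->
  n * n <= 8 * \sum_(x : complete n) #|[set y | phi [set x; y] == c]|.
Proof.
move=> n4 lt.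
have le : #|color_class phi c| <= \sum_(x : complete n) #|[set y | phi [set x; y] == c]|.
  pose P := [set p : complete n * complete n | phi [set p.1; p.2] == c].
  have -> : \sum_(x : complete n) #|[set y | phi [set x; y] == c]| = #|P|.
    rewrite -[RHS]sum1_card (eq_bigr (fun x => \sum_(y | phi [set x; y] == c) 1)).
      by rewrite pair_big_dep; apply: eq_bigl => p; rewrite inE.
    by move=> x _; rewrite sum1_card; apply: eq_card => y; rewrite inE.
  apply: leq_trans (leq_imset_card (fun p => [set p.1; p.2]) (mem P)).
  apply/subset_leq_card/subsetP => d; rewrite inE => /andP[/imsetP[p _ ->] pc].
  by apply: imset_f; rewrite inE.
have : 8 * ('C(n, 2)./2) >= n * n by rewrite bin2; case: (n) n4 => // k k4 /=; nia.
lia.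
Qed.

Lemma balanced_copy_of_pattern (G : sgraph) m n (phi : coloring n) :
    #|G| = 4 * m -> regular G 4 ->
    unavoidable_pattern (fun x y : complete n => phi [set x; y]) #|G|.+1 ->
  has_balanced_copy G phi.
Proof.
move=> cG reg [A [B [a [b [c [[dAB nabc] [cA cB] hA hB hAB]]]]]].
(* Edges are counted twice, [16 * m] in total, so [8 * m] for one color [d] means an equal split. *)
have embed (X : {set G}) d :
    (a == d) * inner X + (b == d) * inner (~: X) + (c == d) * (2 * cut X) = 8 * m ->
  has_balanced_copy G phi.
  have [f [inj_f fA fB]] := embed_split X dAB cA cB.
  rewrite -(color_count_pattern inj_f d fA fB hA hB hAB) => half.
  apply: has_balanced_copy_of_count inj_f _.
  have := color_count_total phi f; rewrite (innerT cG reg).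
  by case: d half; lia.
have [Y cutY] := exists_half_cut cG reg; have [W innerW] := exists_half_inner cG reg.
(* If one side has the crossing color, [W] goes to the other side, whose color then occurs only
   inside [W]. If neither has, the crossing color occurs exactly on the cut of [Y]. *)
case: (eqVneq a c) nabc => [ac|ac] /= nbc.
- by apply: (embed (~: W) b); rewrite ac eqxx setCK innerW eq_sym (negPf nbc); lia.
- case: (eqVneq b c) => [bc|bc].
  + by apply: (embed W a); rewrite bc eqxx innerW eq_sym (negPf ac); lia.
  + by apply: (embed Y c); rewrite (negPf ac) (negPf bc) eqxx cutY; lia.
Qed.

(** Descent to the least bound; excluded middle decides whether a smaller one exists. *)
Lemma exists_bal (G : sgraph) n k : bal_bound G n k -> exists k', is_bal G n k'.
Proof.
have [j] := ubnP k; elim: j k => // j IH k lt bk.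
have [[i [lti bi]]|none] := classic (exists i, i < k /\ bal_bound G n i).
  by apply: IH bi; apply: leq_trans lti _.
exists k; split=> // i bi; rewrite leqNgt; apply/negP => lti.
by apply: none; exists i.
Qed.

Theorem theorem6p5 (G : sgraph) (n : nat) :
  #|G| = n -> n = 0 %[mod 4] -> regular G 4 -> balanceable G.
Proof.
move=> cG n0 reg.
have {cG n0} cG : #|G| = 4 * (n %/ 4).
  by rewrite cG {1}(divn_eq n 4) n0 mod0n addn0 mulnC.
pose t := #|G|.+1; exists (clique_bound (t * 2 ^ (2 * t) + 2 * t + 2)).+4.
(* The largest threshold that the strict upper bound permits: both color classes then have at least
   ['C(N, 2)./2] edges. *)
move=> N leN; apply: (@exists_bal _ _ ('C(N, 2)./2).-1).
have [N4 ltN] : 4 <= N /\ clique_bound (t * 2 ^ (2 * t) + 2 * t + 2) < N.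
  by move: leN; move: (clique_bound _) => q; lia.
have cN : #|complete N| = N := card_ord N.
split=> [|phi red blue].
  by rewrite prednK // half_gt0 bin2; nia.
apply: (balanced_copy_of_pattern cG reg); apply: balanced_pattern.
- by move=> x y; rewrite setUC.
- by rewrite cN => -[]; apply: color_class_dense.
- by rewrite cN.
Qed.
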